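(* For $n\ge 0$ let $p_{n,m}$ be the number of plane forests on $[n]$ with exactly $m$ proper vertices, let $p_n(t)=\sum_{m\ge 0}p_{n,m}t^m$, and let $P=P(x)=\sum_{n\ge 0}p_n(t)\frac{x^n}{n!}$. Then: 1. $P$ satisfies the differential equation $P'=x\,P^2P'+t\,P^3$ with $P(0)=1$, where the prime denotes the derivative with respect to $x$. 2. $P$ satisfies the functional equation $P=\big(1+(2t-1)\,x\,P^2\big)^{t/(2t-1)}$. 3. For $n\ge 1$, $$p_n(t)=t\,\prod_{i=1}^{n-1}\big((2i+1)\,t+(n-i)\big).$$
   Context: $[n]=\{1,\dots,n\}$. A plane tree is a labeled rooted tree in which the children of each vertex are linearly ordered. A plane forest on $[n]$ is a finite sequence $(P_1,\dots,P_m)$ of non-empty plane trees such that $[n]$ is the disjoint union of the vertex sets $V(P_1),\dots,V(P_m)$ (for $n=0$ there is exactly one, the empty sequence, with $0$ proper vertices). A vertex $j$ is a descendant of $i$ if $i$ lies on the path from $j$ to the root of the tree containing $j$ (so $i$ is a descendant of itself). A vertex $i$ is proper if $i$ is the smallest among all its descendants. Here $t$ is an indeterminate and identities are between formal power series in $x$ with coefficients in $\mathbb Q(t)$; for a power series $u$ with zero constant term, $(1+u)^c=\sum_{j\ge 0}\binom{c}{j}u^j$. *)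

(* Defs.v *)
From HB Require Import structures.
From mathcomp Require Import all_boot all_order all_algebra.
From mathcomp Require Import boolp.

Set Implicit Arguments.
Unset Strict Implicit.
Unset Printing Implicit Defensive.

Import GRing.Theory.
Local Open Scope ring_scope.

Inductive plane_tree : Type := PNode of nat & seq plane_tree.

Fixpoint plane_tree_code (T : plane_tree) : GenTree.tree nat :=
  let: PNode a ts := T in GenTree.Node a (map plane_tree_code ts).

Fixpoint plane_tree_decode (t : GenTree.tree nat) : plane_tree :=
  match t with
  | GenTree.Leaf a => PNode a [::]
  | GenTree.Node a ts => PNode a (map plane_tree_decode ts)
  end.

Lemma plane_tree_codeK : cancel plane_tree_code plane_tree_decode.
Proof.
rewrite /cancel; fix IH 1; case=> a ts /=; congr PNode.
by elim: ts => //= t ts ->; rewrite IH.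
Qed.

HB.instance Definition _ :=
  Countable.copy plane_tree (can_type plane_tree_codeK).

Fixpoint tree_vertices (T : plane_tree) : seq nat :=
  let: PNode a ts := T in a :: flatten (map tree_vertices ts).

Definition forest_vertices (F : seq plane_tree) : seq nat :=
  flatten (map tree_vertices F).

(* The path from the root of T to the vertex j (root first, j last); it is
   empty when j is not a vertex of T, so that below a vertex only the subtree
   containing j contributes. Meaningful when the labels of T are distinct. *)
Fixpoint tree_path (j : nat) (T : plane_tree) : seq nat :=
  let: PNode a ts := T in
  if j \in tree_vertices T then a :: flatten (map (tree_path j) ts) else [::].

Definition forest_path (j : nat) (F : seq plane_tree) : seq nat :=
  flatten (map (tree_path j) F).

Definition descendant (F : seq plane_tree) (j i : nat) : bool :=
  (j \in forest_vertices F) && (i \in forest_path j F).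

Definition proper_vertex (F : seq plane_tree) (i : nat) : bool :=
  (i \in forest_vertices F) &&
  all (fun j => descendant F j i ==> (i <= j)%N) (forest_vertices F).

Definition nproper (F : seq plane_tree) : nat :=
  count (proper_vertex F) (forest_vertices F).

(* The permutation condition says at once that the labels inside each tree are
   distinct, that the trees have disjoint vertex sets, and that the union of
   these sets is {1, ..., n}. *)
Record plane_forest (n : nat) : Type := PlaneForest {
  forest_trees :> seq plane_tree;
  _ : perm_eq (forest_vertices forest_trees) (iota 1 n)
}.

HB.instance Definition _ n := [isSub for @forest_trees n].
HB.instance Definition _ n := [Countable of plane_forest n by <:].

(* All forests whose vertices, listed in preorder, are w (k is fuel). *)
Fixpoint forests_of_preorder (k : nat) (w : seq nat) : seq (seq plane_tree) :=
  match k, w with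
  | k'.+1, x :: w' =>
      flatten [seq [seq PNode x cs :: F | cs <- forests_of_preorder k' (take i w'),
                                           F <- forests_of_preorder k' (drop i w')]
              | i <- iota 0 (size w').+1]
  | _, _ => [:: [::]]
  end.

Lemma mem_forests_of_preorder k F : (size (forest_vertices F) <= k)%N ->
  F \in forests_of_preorder k (forest_vertices F).
Proof.
elim: k F => [|k IH] [|[x cs] F] //.
have -> : forest_vertices (PNode x cs :: F)
  = x :: forest_vertices cs ++ forest_vertices F by [].
rewrite [size _]/= size_cat ltnS => le_k.
apply/flatten_mapP; exists (size (forest_vertices cs)).
  by rewrite mem_iota size_cat ltnS leq_addr.
rewrite take_size_cat // drop_size_cat //.
by apply: (@allpairs_f _ _ _ (fun cs F => PNode x cs :: F)); apply: IH;
  apply: leq_trans le_k; rewrite ?leq_addr ?leq_addl.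
Qed.

Definition plane_forest_enum (n : nat) : seq (plane_forest n) :=
  undup (pmap insub (flatten [seq forests_of_preorder n w
                             | w <- permutations (iota 1 n)])).

Lemma plane_forest_enumP n : Finite.axiom (plane_forest_enum n).
Proof.
apply: Finite.uniq_enumP; first exact: undup_uniq.
case=> F FP; rewrite mem_undup mem_pmap_sub; apply/flatten_mapP => /=.
exists (forest_vertices F); first by rewrite mem_permutations.
apply: mem_forests_of_preorder.
by rewrite (perm_size FP) size_iota.
Qed.

HB.instance Definition _ n :=
  isFinite.Build (plane_forest n) (@plane_forest_enumP n).

Definition p_nm (n m : nat) : nat :=
  #|[set F : plane_forest n | nproper F == m]|.

(* The sum over all m stops at m = n, see coef_p_poly. *)
Definition p_poly (n : nat) : {poly rat} := \poly_(m < n.+1) (p_nm n m)%:R.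

Lemma nproper_le n (F : plane_forest n) : (nproper F <= n)%N.
Proof.
case: F => F FP /=; rewrite -[leqRHS](size_iota 1) -(perm_size FP).
exact: count_size.
Qed.

Lemma coef_p_poly n m : (p_poly n)`_m = (p_nm n m)%:R.
Proof.
rewrite coef_poly; case: ltnP => // lt_nm; rewrite /p_nm.
suff -> : [set F : plane_forest n | nproper F == m] = set0 by rewrite cards0.
apply/setP=> F; rewrite !inE; apply: contraTF lt_nm => /eqP <-.
by rewrite -leqNgt nproper_le.
Qed.

Record fps (K : Type) : Type := FPS { fps_coef : nat -> K }.

HB.instance Definition _ (K : Type) := gen_eqMixin (fps K).
HB.instance Definition _ (K : Type) := gen_choiceMixin (fps K).

Lemma fpsP (K : Type) (f g : fps K) : fps_coef f =1 fps_coef g <-> f = g.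
Proof. by split=> [|->//]; case: f g => [f] [g] /= /funext ->. Qed.

Section FormalPowerSeries.
Variable K : comNzRingType.
Implicit Types f g h : fps K.

Definition fpsC (a : K) : fps K := FPS (fun n => if n is 0 then a else 0).
Definition fpsX : fps K := FPS (fun n => (n == 1%N)%:R).

Definition fps_add f g := FPS (fun n => fps_coef f n + fps_coef g n).
Definition fps_opp f := FPS (fun n => - fps_coef f n).
Definition fps_mul f g :=
  FPS (fun n => \sum_(i < n.+1) fps_coef f i * fps_coef g (n - i)).
Definition fps_deriv f := FPS (fun n => fps_coef f n.+1 *+ n.+1).

Fact fps_addA : associative fps_add.
Proof. by move=> f g h; apply/fpsP=> n /=; rewrite addrA. Qed.
Fact fps_addC : commutative fps_add.
Proof. by move=> f g; apply/fpsP=> n /=; rewrite addrC. Qed.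
Fact fps_add0 : left_id (fpsC 0) fps_add.
Proof. by move=> f; apply/fpsP=> -[|n] /=; rewrite add0r. Qed.
Fact fps_addN : left_inverse (fpsC 0) fps_opp fps_add.
Proof. by move=> f; apply/fpsP=> -[|n] /=; rewrite addNr. Qed.

HB.instance Definition _ :=
  GRing.isZmodule.Build (fps K) fps_addA fps_addC fps_add0 fps_addN.

Fact fps_mulC : commutative fps_mul.
Proof.
move=> f g; apply/fpsP=> n /=; rewrite (reindex_inj rev_ord_inj) /=.
by apply: eq_bigr => i _; rewrite mulrC subSS subKn // -ltnS.
Qed.

Fact fps_mulA : associative fps_mul.
Proof.
move=> p q r; apply/fpsP=> i; rewrite [p in LHS]lock fps_mulC -lock.
rewrite [in RHS]fps_mulC /=.
rewrite (reindex_inj rev_ord_inj) /= [RHS](reindex_inj rev_ord_inj) /=.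
pose coef3 j k :=
  fps_coef p j * (fps_coef q (i - j - k)%N * fps_coef r k).
transitivity (\sum_(j < i.+1) \sum_(k < i.+1 | (k <= i - j)%N) coef3 j k).
  apply: eq_bigr => /= j _; rewrite subSS subKn -1?ltnS // mulrC.
  have /fpsP/(_ (i - j)%N)/= -> := fps_mulC q r.
  rewrite big_distrr /= (big_ord_narrow_leq (leq_subr _ _)).
  by apply: eq_bigr => k _; rewrite /coef3 (mulrC (fps_coef r k)).
rewrite (exchange_big_dep predT) //= [RHS](reindex_inj rev_ord_inj) /=.
apply: eq_bigr => k _; rewrite !subSS subKn -1?ltnS //.
transitivity (\sum_(j < i.+1 | (j <= i - k)%N) coef3 j k).
  apply: eq_bigl => j; rewrite -ltnS -(ltnS j) -!subSn ?leq_ord //.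
  by rewrite -subn_gt0 -(subn_gt0 j) -!subnDA addnC.
rewrite (big_ord_narrow_leq (leq_subr _ _)) mulrC big_distrl /=.
by apply: eq_bigr => j _; rewrite /coef3 -!subnDA addnC mulrA.
Qed.

Fact fps_mul1 : left_id (fpsC 1) fps_mul.
Proof.
move=> f; apply/fpsP=> n /=; rewrite big_ord_recl subn0 mul1r.
by rewrite big1 ?addr0 // => j _; rewrite mul0r.
Qed.

Fact fps_mulDl : left_distributive fps_mul fps_add.
Proof.
move=> f g h; apply/fpsP=> n /=; rewrite -big_split /=.
by apply: eq_bigr => j _; rewrite mulrDl.
Qed.

Fact fps_1neq0 : fpsC 1 != 0.
Proof.
apply/eqP=> /fpsP/(_ 0%N)/= /eqP; exact/negP/oner_neq0.
Qed.

HB.instance Definition _ := GRing.Zmodule_isComNzRing.Build (fps K)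
  fps_mulA fps_mulC fps_mul1 fps_mulDl fps_1neq0.

Lemma fps_coefM f g n :
  fps_coef (f * g) n = \sum_(i < n.+1) fps_coef f i * fps_coef g (n - i).
Proof. by []. Qed.

Lemma fps_coefX_eq0 f k n :
  fps_coef f 0 = 0 -> (n < k)%N -> fps_coef (f ^+ k) n = 0.
Proof.
move=> f0; elim: k n => // k IH n; rewrite ltnS => le_nk.
rewrite exprS fps_coefM big_ord_recl f0 mul0r add0r big1 // => i _.
by rewrite IH ?mulr0 //; case: n le_nk i => [|n] le_nk [i lt_i] //=;
  rewrite /bump /= add1n subSS (leq_ltn_trans (leq_subr _ _)).
Qed.

End FormalPowerSeries.

Section BinomialPower.
Variable K : fieldType.

Definition gbinom (c : K) (j : nat) : K :=
  (\prod_(i < j) (c - i%:R)) / (j`!)%:R.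

(* f ^ c = sum_(j >= 0) gbinom c j * (f - 1)^j, for f with constant term 1;
   the terms with j > n do not contribute to the coefficient of x^n, see
   fps_powE. *)
Definition fps_pow (f : fps K) (c : K) : fps K :=
  FPS (fun n => \sum_(j < n.+1) gbinom c j * fps_coef ((f - 1) ^+ j) n).

Lemma fps_powE (f : fps K) (c : K) n N : fps_coef f 0 = 1 -> (n < N)%N ->
  fps_coef (fps_pow f c) n =
  \sum_(j < N) gbinom c j * fps_coef ((f - 1) ^+ j) n.
Proof.
move=> f0 lt_nN; rewrite /= (big_ord_widen _
  (fun j => gbinom c j * fps_coef ((f - 1) ^+ j) n) lt_nN) big_mkcond /=.
apply: eq_bigr => j _; case: ltnP => // lt_nj.
by rewrite fps_coefX_eq0 ?mulr0 //= f0 subrr.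
Qed.

End BinomialPower.

(* Q(t), with t the class of the polynomial variable. *)
Definition Qt : fieldType := {fraction {poly rat}}.
Definition tQ : Qt := tofrac 'X.

Definition P_series : fps Qt :=
  FPS (fun n => tofrac (p_poly n) / (n`!)%:R).

(* Main.v *)
From HB Require Import structures.
Require Import Defs.
From mathcomp Require Import all_boot all_order all_algebra.
From mathcomp Require Import ring.
Set Implicit Arguments.
Unset Strict Implicit.
Unset Printing Implicit Defensive.

Import GRing.Theory.
Local Open Scope ring_scope.

(** A nonempty plane forest is a root x, the forest cs of its children and the
    forest F of the remaining trees.  Whether a vertex of cs or F is proper is
    decided inside cs or F, and x is proper iff x is the least label of the
    first tree ([nproper_cons]).  Once the i + 1 labels of the first tree are
    chosen, any of them may be the root, and each choice leaves i labels for cs,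
    of which only the relative order matters; exactly one choice makes the root
    proper.  The root thus contributes a factor t + i, and
      p_{n+1} = sum_i binom(n+1, i+1) (t + i) p_i p_{n-i}   ([p_polyS]).
    To carry this out, a forest is recorded by its preorder word: the forests
    with labels in s are summed over the permutations of s, and the choice of
    the labels of the first tree is the splitting of a permutation into a prefix
    and a suffix ([sum_permutations_split]).

    With T = sum_i (t + i) p_i x^(i+1) / ((i + 1) i!), the generating function
    of plane trees, the recursion reads P = 1 + T P, while T' = x P' + t P.
    Differentiating 1/P = 1 - T gives P' = P^2 T', which is the differential
    equation ([ode_of_convolution]).

    For the functional equation put f = 1 + (2t - 1) x P^2 and c = t/(2t - 1).
    The differential equation rearranges to P' f = c f' P, and f^c satisfies the
    same first order linear equation with the same constant term
    ([functional_equation_of_ode]).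

    For the product formula, multiply the differential equation by r P^(r-1):
      (P^r)' = r/(r+2) x (P^(r+2))' + t r P^(r+2).
    So the coefficient of x^(n+1) in P^r is an explicit multiple of that of x^n
    in P^(r+2) ([coef_pow_recursion]).  Keeping r general, n steps of this linear
    recursion produce the n factors of the product ([coef_pow_product]), and r = 1
    is the claim. *)

(** * Proper vertices of a decomposed forest *)

(** The principle generated for the nested type gives no hypothesis on the list
    of children; this one follows the decomposition of a forest at its first
    root. *)
Lemma forest_ind (Q : seq plane_tree -> Prop) :
    Q [::] -> (forall x cs F, Q cs -> Q F -> Q (PNode x cs :: F)) ->
  forall F, Q F.
Proof.
move=> Q0 QS; suff QT T : forall F, Q F -> Q (T :: F).
  by elim=> [|T F IH] //; apply: QT.
move: T; fix IH 1; case=> x cs F QF; apply: QS => //.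
by elim: cs => [|c cs IHcs] //; apply: IH.
Qed.

Lemma forest_vertices_cons x cs F :
  forest_vertices (PNode x cs :: F)
  = x :: (forest_vertices cs ++ forest_vertices F).
Proof. by []. Qed.

Lemma forest_path_cons j x cs F :
  forest_path j (PNode x cs :: F)
  = (if j \in x :: forest_vertices cs then x :: forest_path j cs else [::])
    ++ forest_path j F.
Proof. by []. Qed.

Lemma forest_path_sub j F : {subset forest_path j F <= forest_vertices F}.
Proof.
elim/forest_ind: F => // x cs F IHcs IHF i.
rewrite forest_path_cons forest_vertices_cons mem_cat; case: ifP => _.
2: by move/IHF=> iF; rewrite inE mem_cat iF !orbT.
rewrite !inE mem_cat.
by rewrite -orbA => /or3P[->//|/IHcs->|/IHF->]; rewrite !orbT.
Qed.

Lemma forest_path_notin j F :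
  j \notin forest_vertices F -> forest_path j F = [::].
Proof.
elim/forest_ind: F => // x cs F _ IHF.
rewrite forest_path_cons forest_vertices_cons -cat_cons mem_cat negb_or.
by case/andP=> /negPf-> /IHF->.
Qed.

Lemma descendantE F j i : descendant F j i = (i \in forest_path j F).
Proof.
rewrite /descendant; case: (boolP (j \in _)) => //.
by move/forest_path_notin->.
Qed.

Lemma proper_vertexE F i : i \in forest_vertices F ->
  proper_vertex F i
  = all (fun j => (i \in forest_path j F) ==> (i <= j)%N) (forest_vertices F).
Proof.
by move=> iF; rewrite /proper_vertex iF; apply: eq_all => j; rewrite descendantE.
Qed.

Lemma all_not_descendant F i s :
    (forall j, j \in s -> i \notin forest_path j F) ->
  all (fun j => (i \in forest_path j F) ==> (i <= j)%N) s.
Proof. by move=> H; apply/allP=> j /H /negPf->. Qed.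

(** Distinctness of the labels is what keeps the three parts apart: no path of
    one part meets a vertex of another, except that the root x lies above every
    vertex of cs. *)
Lemma nproper_cons x cs F : uniq (forest_vertices (PNode x cs :: F)) ->
  nproper (PNode x cs :: F)
  = (all (leq x) (forest_vertices cs) + nproper cs + nproper F)%N.
Proof.
rewrite forest_vertices_cons /= mem_cat negb_or cat_uniq.
case/andP=> /andP[x_cs x_F] /and3P[_ dis _].
have disF i : i \in forest_vertices cs -> i \notin forest_vertices F.
  by move=> i_cs; apply: contraNN dis => i_F; apply/hasP; exists i.
have outp i j G : i \notin forest_vertices G -> i \notin forest_path j G.
  by apply: contraNN; apply: forest_path_sub.
rewrite /nproper forest_vertices_cons /= count_cat -addnA; congr (_ + (_ + _))%N.
- congr nat_of_bool; rewrite proper_vertexE ?mem_head // forest_vertices_cons.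
  rewrite /= leqnn implybT /= all_cat [X in _ && X]all_not_descendant.
    rewrite andbT; apply: eq_in_all => j j_cs.
    by rewrite forest_path_cons inE j_cs orbT mem_head.
  move=> j j_F; rewrite forest_path_cons mem_cat negb_or outp // andbT.
  rewrite inE; case: eqP => [j_x|_] /=; first by rewrite -j_x j_F in x_F.
  by case: ifP => // /disF; rewrite j_F.
- apply: eq_in_count => i i_cs; have i_F := disF i i_cs.
  have i_x : i != x by apply: contraNneq x_cs => <-.
  have pathE j : (i \in forest_path j (PNode x cs :: F)) = (i \in forest_path j cs).
    rewrite forest_path_cons mem_cat (negPf (outp i j F i_F)) orbF.
    case: ifP => [_|/negbT]; first by rewrite inE (negPf i_x).
    by rewrite inE negb_or => /andP[_ /forest_path_notin->].
  rewrite !proper_vertexE ?forest_vertices_cons ?inE ?mem_cat ?i_cs ?orbT //.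
  under [in LHS]eq_all => j do rewrite pathE.
  rewrite /= all_cat (forest_path_notin x_cs) /= [X in _ && X]all_not_descendant.
    by rewrite andbT.
  by move=> j j_F; rewrite forest_path_notin //; apply: contraTN j_F; exact: disF.
- apply: eq_in_count => i i_F.
  have i_cs : i \notin forest_vertices cs by apply: contraTN i_F; exact: disF.
  have i_x : i != x by apply: contraNneq x_F => <-.
  have pathE j : (i \in forest_path j (PNode x cs :: F)) = (i \in forest_path j F).
    rewrite forest_path_cons mem_cat; case: ifP => // _.
    by rewrite inE (negPf i_x) (negPf (outp i j cs i_cs)).
  rewrite !proper_vertexE ?forest_vertices_cons ?inE ?mem_cat ?i_F ?orbT //.
  under [in LHS]eq_all => j do rewrite pathE.
  rewrite /= all_cat (forest_path_notin x_F) /= [X in X && _]all_not_descendant //.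
  by move=> j /disF j_F; rewrite forest_path_notin.
Qed.

(** * Forests listed by their preorder words *)

(** The lists are pairwise disjoint because an element remembers, through key,
    the list it comes from. *)
Lemma uniq_flatten_key (I T : eqType) (key : T -> I) (s : seq I) (t : I -> seq T) :
    uniq s -> {in s, forall i, uniq (t i)} ->
    {in s, forall i, {in t i, forall y, key y = i}} ->
  uniq (flatten (map t s)).
Proof.
elim: s => //= i s IH /andP[i_s us] ut ky.
rewrite cat_uniq ut ?mem_head //= IH //; first last.
- by move=> j j_s; apply: ky; rewrite inE j_s orbT.
- by move=> j j_s; apply: ut; rewrite inE j_s orbT.
rewrite andbT; apply/hasPn => y /flatten_mapP[j j_s y_j].
apply: contra i_s => y_i; rewrite -(ky i _ y y_i) ?mem_head //.
by rewrite (ky j _ y y_j) // inE j_s orbT.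
Qed.

Lemma big_flatten_map (R I T : Type) (idx : R) (op : Monoid.law idx)
    (s : seq I) (t : I -> seq T) (f : T -> R) :
  \big[op/idx]_(y <- flatten [seq t i | i <- s]) f y
  = \big[op/idx]_(i <- s) \big[op/idx]_(y <- t i) f y.
Proof. by rewrite big_flatten big_map. Qed.

Lemma sumr_const_seq (V : nmodType) (I : Type) (s : seq I) (x : V) :
  \sum_(i <- s) x = x *+ size s.
Proof. by rewrite big_const_seq count_predT iter_addr_0. Qed.

Lemma forests_of_preorder_cons k x w :
  forests_of_preorder k.+1 (x :: w)
  = flatten [seq [seq PNode x cs :: F | cs <- forests_of_preorder k (take i w),
                                        F <- forests_of_preorder k (drop i w)]
            | i <- iota 0 (size w).+1].
Proof. by []. Qed.

Lemma forest_vertices_of_preorder k w F : (size w <= k)%N ->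
  F \in forests_of_preorder k w -> forest_vertices F = w.
Proof.
elim: k w F => [|k IH] [|x w] F //; do ?by move=> _; rewrite inE => /eqP->.
rewrite forests_of_preorder_cons ltnS => le_w /flatten_mapP[i].
rewrite mem_iota ltnS => le_i.
case/allpairsP=> -[cs G] [/= cs_in G_in ->].
rewrite forest_vertices_cons (IH _ _ _ cs_in) ?(IH _ _ _ G_in) ?cat_take_drop //.
  by rewrite size_drop (leq_trans (leq_subr _ _)).
by rewrite size_takel // (leq_trans le_i).
Qed.

Lemma forests_of_preorder_uniq k w : (size w <= k)%N ->
  uniq (forests_of_preorder k w).
Proof.
elim: k w => [|k IH] [|x w] //; rewrite forests_of_preorder_cons ltnS => le_w.
have le_take i : (size (take i w) <= k)%N.
  by rewrite size_take_min (leq_trans (geq_minr _ _)).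
have le_drop i : (size (drop i w) <= k)%N.
  by rewrite size_drop (leq_trans (leq_subr _ _)).
pose key F := if F is PNode _ cs :: _ then size (forest_vertices cs) else 0%N.
apply: (@uniq_flatten_key _ _ key) => [|i _|i i_w F]; first exact: iota_uniq.
  by apply: allpairs_uniq => [||[c1 F1] [c2 F2] _ _ /= [-> ->]] //; apply: IH.
case/allpairsP=> -[cs G] [/= cs_in _ ->] /=.
rewrite (forest_vertices_of_preorder (le_take i) cs_in) size_takel //.
by move: i_w; rewrite mem_iota ltnS.
Qed.

(** The natural number k is the recursion bound of the enumeration of forests; it is
    immaterial as soon as it is at least the size of w. *)
Definition preorder_weight k w : {poly rat} :=
  \sum_(F <- forests_of_preorder k w) 'X ^+ nproper F.

Lemma p_poly_sum_preorder n :
  p_poly n = \sum_(w <- permutations (iota 1 n)) preorder_weight n w.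
Proof.
transitivity (\sum_(F : plane_forest n) 'X ^+ nproper F : {poly rat}).
  apply/polyP=> m; rewrite coef_p_poly coef_sum /p_nm -sum1_card natr_sum.
  rewrite big_mkcond /=; apply: eq_bigr => F _.
  by rewrite inE coefXn eq_sym; case: eqP.
have sz w : w \in permutations (iota 1 n) -> (size w <= n)%N.
  by rewrite mem_permutations => /perm_size->; rewrite size_iota.
rewrite -(big_map _ xpredT (fun F => 'X ^+ nproper F)) /preorder_weight.
rewrite -big_flatten_map; apply: perm_big; apply: uniq_perm.
- by rewrite map_inj_uniq ?index_enum_uniq //; apply: val_inj.
- apply: (@uniq_flatten_key _ _ forest_vertices); first exact: permutations_uniq.
    by move=> w /sz; apply: forests_of_preorder_uniq.
  by move=> w /sz le_w F; apply: forest_vertices_of_preorder.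
move=> F; apply/mapP/flatten_mapP => [[G _ ->]|[w w_in F_in]].
  exists (forest_vertices G); first by rewrite mem_permutations (valP G).
  apply: mem_forests_of_preorder.
  by rewrite (perm_size (valP G)) size_iota.
have FP : perm_eq (forest_vertices F) (iota 1 n).
  by rewrite (forest_vertices_of_preorder (sz w w_in) F_in) -mem_permutations.
by exists (PlaneForest FP); rewrite ?mem_index_enum.
Qed.

(** The exponent tests whether the root of a tree with preorder word w is proper;
    the empty word is the preorder word of no tree. *)
Definition tree_preorder_weight k w : {poly rat} :=
  if w is x :: u then 'X ^+ all (leq x) u * preorder_weight k u else 0.

(** The index i is the number of vertices below the first root, so the first tree
    occupies a prefix of i + 1 letters. *)
Lemma preorder_weight_cons k x w : uniq (x :: w) -> (size w <= k)%N ->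
  preorder_weight k.+1 (x :: w)
  = \sum_(i < (size w).+1)
      tree_preorder_weight k (take i.+1 (x :: w))
      * preorder_weight k (drop i.+1 (x :: w)).
Proof.
move=> u_w le_w; rewrite {1}/preorder_weight forests_of_preorder_cons big_flatten_map.
rewrite -[(size w).+1]subn0 -/(index_iota 0 (size w).+1) big_mkord; apply: eq_bigr => i _.
rewrite big_allpairs_dep /= -/(preorder_weight _ _) -mulrA [in RHS]/preorder_weight.
rewrite big_distrl [RHS]big_distrr; apply: eq_big_seq => cs cs_in /=.
rewrite big_distrr /= [RHS]big_distrr; apply: eq_big_seq => F F_in /=.
have csE : forest_vertices cs = take i w.
  apply: forest_vertices_of_preorder cs_in.
  by rewrite size_take_min (leq_trans (geq_minr _ _)).
have FE : forest_vertices F = drop i w.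
  apply: forest_vertices_of_preorder F_in.
  by rewrite size_drop (leq_trans (leq_subr _ _)).
rewrite nproper_cons ?csE ?exprD ?mulrA //.
by rewrite forest_vertices_cons csE FE cat_take_drop.
Qed.

(** * Splitting permutations into a prefix and a suffix *)

(** A double count replaces the choice of the set of letters of the prefix.  Call
    two permutations of s equivalent when their prefixes of length k have the
    same letters, hence also their suffixes.  Every class has k! l! members, and
    the sum of phi * psi over each class is c * d, whatever the letters; now sum
    phi * psi over all pairs of equivalent permutations in both orders. *)
Lemma sum_permutations_split (R : comNzRingType) (T : eqType) (s : seq T)
    (k l : nat) (phi psi : seq T -> R) (c d : R) :
    uniq s -> size s = (k + l)%N ->
    (forall u, uniq u -> size u = k -> \sum_(v <- permutations u) phi v = c) ->
    (forall u, uniq u -> size u = l -> \sum_(v <- permutations u) psi v = d) ->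
  (k`! * l`!)%:R * (\sum_(w <- permutations s) phi (take k w) * psi (drop k w))
  = ((k + l)`!)%:R * (c * d).
Proof.
move=> us sz_s phiE psiE.
pose same (w z : seq T) := perm_eq (take k w) (take k z) && perm_eq (drop k w) (drop k z).
have same_sym w z : same w z = same z w by rewrite /same perm_sym [X in _ && X]perm_sym.
have word w : w \in permutations s ->
    [/\ uniq (take k w), uniq (drop k w), size (take k w) = k & size (drop k w) = l].
  rewrite mem_permutations => w_s; have sz_w := perm_size w_s.
  rewrite take_uniq ?drop_uniq ?(perm_uniq w_s) //.
  by rewrite size_take_min size_drop sz_w sz_s addKn (minn_idPl (leq_addr _ _)).
(* The class of w consists of the concatenations of a rearranged prefix and a
   rearranged suffix. *)
have fiber w (f : seq T -> R) : w \in permutations s ->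
    \sum_(z <- permutations s | same w z) f z
    = \sum_(u <- permutations (take k w)) \sum_(v <- permutations (drop k w)) f (u ++ v).
  move=> w_s; have [u1 u2 s1 s2] := word w w_s.
  rewrite -big_filter -(big_allpairs_dep (F := f)); apply: perm_big.
  apply: uniq_perm; first by rewrite filter_uniq // permutations_uniq.
    apply: allpairs_uniq; rewrite ?permutations_uniq // => -[a b] [a' b'].
    case/allpairsP=> -[? ?] [/= a_in b_in [-> ->]].
    case/allpairsP=> -[? ?] [/= a'_in b'_in [-> ->]] /= /eqP.
    rewrite !mem_permutations in a_in a'_in.
    rewrite eqseq_cat ?(perm_size a_in) ?(perm_size a'_in) //.
    by case/andP=> /eqP-> /eqP->.
  move=> z; rewrite mem_filter; apply/andP/allpairsP.
    case=> /andP[wz1 wz2] _; exists (take k z, drop k z).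
    rewrite /= !mem_permutations cat_take_drop.
    by rewrite (perm_sym (take k z)) (perm_sym (drop k z)).
  case=> -[a b] [/=]; rewrite !mem_permutations => a_w b_w ->.
  have sz_a : size a = k by rewrite (perm_size a_w).
  rewrite /same take_size_cat // drop_size_cat //.
  rewrite (perm_sym (take k w)) a_w (perm_sym (drop k w)) b_w.
  split=> //; rewrite -(permPr (_ : perm_eq w s)) -?mem_permutations //.
  by rewrite mem_permutations -[X in perm_eq _ X](cat_take_drop k w) perm_cat.
pose f w := phi (take k w) * psi (drop k w).
transitivity (\sum_(w <- permutations s) \sum_(z <- permutations s | same w z) f z).
  rewrite (exchange_big_dep xpredT) //= big_distrr; apply: eq_big_seq => z z_s /=.
  under eq_bigl do rewrite same_sym.
  rewrite -/(f z) fiber //; have [u1 u2 s1 s2] := word z z_s.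
  by rewrite !sumr_const_seq !size_permutations // s1 s2 -mulrnA mulr_natl mulnC.
rewrite -sz_s -(size_permutations us) mulr_natl -sumr_const_seq.
apply: eq_big_seq => w w_s; rewrite fiber //; have [u1 u2 s1 s2] := word w w_s.
rewrite -(phiE _ u1 s1) -(psiE _ u2 s2) big_distrl; apply: eq_big_seq => a /= a_in.
rewrite big_distrr; apply: eq_bigr => b _ /=.
have sz_a : size a = k by rewrite mem_permutations in a_in; rewrite (perm_size a_in).
by rewrite /f take_size_cat // drop_size_cat.
Qed.

(** * The recursion for the polynomials p_n *)

Lemma uniq_min_perm (s : seq nat) : uniq s -> (0 < size s)%N ->
  exists m r, perm_eq s (m :: r) /\ all (ltn m) r.
Proof.
move=> us; rewrite -(size_sort leq).
have: sorted ltn (sort leq s).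
  by rewrite ltn_sorted_uniq_leq sort_uniq us sort_sorted //; apply: leq_total.
have: perm_eq s (sort leq s) by rewrite perm_sym perm_sort.
case: (sort leq s) => // m r s_mr lt_mr _; exists m, r; split=> //.
exact: order_path_min ltn_trans lt_mr.
Qed.

(** Only the minimum of s passes the test. *)
Lemma sum_root_minimal (s : seq nat) n : uniq s -> size s = n.+1 ->
  \sum_(x <- s) 'X ^+ all (leq x) s = 'X + n%:R :> {poly rat}.
Proof.
move=> us sz_s; have [|m [r [s_mr lt_mr]]] := uniq_min_perm us; first by rewrite sz_s.
have sz_r : size r = n by have := perm_size s_mr; rewrite sz_s => -[].
under eq_bigr do rewrite (perm_all _ s_mr).
rewrite (perm_big _ s_mr) big_cons /= leqnn.
have -> : all (leq m) r by apply: sub_all lt_mr => y /ltnW.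
rewrite -sz_r -sumr_const_seq; congr (_ + _); apply: eq_big_seq => x x_r.
have lt_mx : (m < x)%N := allP lt_mr x x_r.
by rewrite leqNgt lt_mx.
Qed.

Lemma sum_tree_preorder_weight k n c (s : seq nat) : uniq s -> size s = n.+1 ->
    (forall u, uniq u -> size u = n ->
      \sum_(v <- permutations u) preorder_weight k v = c) ->
  \sum_(w <- permutations s) tree_preorder_weight k w = ('X + n%:R) * c.
Proof.
move=> us sz_s sumE; rewrite (perm_big _ (permutationsE _)) ?sz_s //.
rewrite undup_id // big_allpairs_dep -(sum_root_minimal us sz_s) big_distrl.
apply: eq_big_seq => x x_s /=; have s_x := perm_to_rem x_s.
rewrite -(sumE (rem x s)) ?rem_uniq ?size_rem ?sz_s // big_distrr.
apply: eq_big_seq => u; rewrite mem_permutations => u_x /=.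
by rewrite (perm_all _ s_x) /= leqnn (perm_all _ u_x).
Qed.

Lemma natr_poly_neq0 n : (0 < n)%N -> n%:R != 0 :> {poly rat}.
Proof. by rewrite -polyC_natr polyC_eq0 Num.Theory.pnatr_eq0 -lt0n. Qed.

Definition forest_convolution n : {poly rat} :=
  \sum_(i < n.+1) 'C(n.+1, i.+1)%:R * (('X + i%:R) * p_poly i * p_poly (n - i)).

(** The right-hand side depends on s through its size alone: this is how the
    invariance of the sum under relabeling passes from smaller label sets to
    larger ones. *)
Lemma sum_preorder_weightS k n (s : seq nat) : uniq s -> size s = n.+1 -> (n <= k)%N ->
    (forall u, uniq u -> (size u <= n)%N ->
      \sum_(v <- permutations u) preorder_weight k v = p_poly (size u)) ->
  \sum_(w <- permutations s) preorder_weight k.+1 w = forest_convolution n.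
Proof.
move=> us sz_s le_nk sumE.
transitivity (\sum_(i < n.+1) \sum_(w <- permutations s)
    tree_preorder_weight k (take i.+1 w) * preorder_weight k (drop i.+1 w)).
  rewrite [RHS]exchange_big; apply: eq_big_seq => w /=; rewrite mem_permutations => w_s.
  have: size w = n.+1 by rewrite (perm_size w_s).
  have: uniq w by rewrite (perm_uniq w_s).
  by case: w {w_s} => // x w uw [sz_w]; rewrite preorder_weight_cons ?sz_w.
apply: eq_bigr => -[i lt_i] _ /=; have le_in : (i <= n)%N by rewrite -ltnS.
have fact_neq0 : ((i.+1)`! * (n - i)`!)%:R != 0 :> {poly rat}.
  by rewrite natr_poly_neq0 // muln_gt0 !fact_gt0.
apply: (mulfI fact_neq0).
have split_n : n.+1 = (i.+1 + (n - i))%N by rewrite addSn subnKC.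
rewrite (@sum_permutations_split _ _ _ _ _ _ _ (('X + i%:R) * p_poly i) (p_poly (n - i))).
- rewrite -split_n [RHS]mulrA -natrM; congr (_%:R * _).
  by rewrite -(bin_fact lt_i) subSS mulnC.
- by [].
- by rewrite sz_s.
- move=> u uu sz_u; apply: sum_tree_preorder_weight => // v uv sz_v.
  by rewrite sumE ?sz_v.
by move=> u uu sz_u; rewrite sumE ?sz_u ?leq_subr.
Qed.

(** Since [p_poly] is itself the sum for the labels 1, ..., n and bound n, the
    statement says that neither the labels nor the bound matter.  Both sums
    satisfy the recursion of [sum_preorder_weightS], so they agree by induction
    on the bound. *)
Lemma sum_preorder_weight k (s : seq nat) : uniq s -> (size s <= k)%N ->
  \sum_(w <- permutations s) preorder_weight k w = p_poly (size s).
Proof.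
have [m] := ubnP k; elim: m k s => // m IH [|k] s lt_km us.
  by rewrite leqn0 size_eq0 => /eqP->; rewrite p_poly_sum_preorder.
case sz_s: (size s) => [|n] le_nk.
  move/eqP: sz_s; rewrite size_eq0 => /eqP->.
  by rewrite p_poly_sum_preorder !big_seq1 /preorder_weight.
rewrite ltnS in le_nk; rewrite ltnS in lt_km.
rewrite (@sum_preorder_weightS k n) // => [|u uu le_u]; last first.
  by apply: IH => //; apply: leq_trans le_nk.
rewrite p_poly_sum_preorder (@sum_preorder_weightS n n) ?iota_uniq ?size_iota //.
by move=> u uu le_u; apply: IH => //; apply: leq_ltn_trans lt_km.
Qed.

Lemma p_poly0 : p_poly 0 = 1.
Proof. by rewrite p_poly_sum_preorder big_seq1 /preorder_weight big_seq1. Qed.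

Lemma p_polyS n : p_poly n.+1
  = \sum_(i < n.+1) 'C(n.+1, i.+1)%:R * (('X + i%:R) * p_poly i * p_poly (n - i)).
Proof.
rewrite p_poly_sum_preorder (@sum_preorder_weightS n n) ?iota_uniq ?size_iota //.
by move=> u uu; apply: sum_preorder_weight.
Qed.

(** * Calculus of formal power series *)

Lemma fps_coefD (K : comNzRingType) (f g : fps K) n :
  fps_coef (f + g) n = fps_coef f n + fps_coef g n.
Proof. by []. Qed.

Lemma fps_coefB (K : comNzRingType) (f g : fps K) n :
  fps_coef (f - g) n = fps_coef f n - fps_coef g n.
Proof. by []. Qed.

Lemma fps_coef1 (K : comNzRingType) n : fps_coef (1 : fps K) n = (n == 0%N)%:R.
Proof. by case: n. Qed.

Lemma fps_coef0 (K : comNzRingType) n : fps_coef (0 : fps K) n = 0.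
Proof. by case: n. Qed.

Lemma fps_coefCM (K : comNzRingType) (a : K) (f : fps K) n :
  fps_coef (fpsC a * f) n = a * fps_coef f n.
Proof.
by rewrite fps_coefM big_ord_recl big1 ?addr0 ?subn0 // => i _; rewrite mul0r.
Qed.

Lemma fps_coefXM (K : comNzRingType) (f : fps K) n :
  fps_coef (fpsX K * f) n.+1 = fps_coef f n.
Proof.
rewrite fps_coefM big_ord_recl mul0r add0r big_ord_recl mul1r subn1.
by rewrite big1 ?addr0 // => i _; rewrite mul0r.
Qed.

Lemma fps_coefXM0 (K : comNzRingType) (f : fps K) : fps_coef (fpsX K * f) 0 = 0.
Proof. by rewrite fps_coefM big_ord1 mul0r. Qed.

Lemma fps_coefM0 (K : comNzRingType) (f g : fps K) :
  fps_coef (f * g) 0 = fps_coef f 0 * fps_coef g 0.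
Proof. by rewrite fps_coefM big_ord1. Qed.

Lemma fps_coefX0 (K : comNzRingType) (f : fps K) r :
  fps_coef (f ^+ r) 0 = fps_coef f 0 ^+ r.
Proof. by elim: r => // r IH; rewrite !exprS fps_coefM0 IH. Qed.

Lemma fps_coef_sum (K : comNzRingType) I (s : seq I) (F : I -> fps K) n :
  fps_coef (\sum_(i <- s) F i) n = \sum_(i <- s) fps_coef (F i) n.
Proof.
elim: s => [|i s IH]; first by rewrite !big_nil fps_coef0.
by rewrite !big_cons fps_coefD IH.
Qed.

Lemma fpsC_is_monoid_morphism (K : comNzRingType) : monoid_morphism (@fpsC K).
Proof.
split=> // a b; apply/fpsP=> n; rewrite fps_coefCM.
by case: n => //= n; rewrite mulr0.
Qed.

Lemma fpsC_is_zmod_morphism (K : comNzRingType) : zmod_morphism (@fpsC K).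
Proof. by move=> a b; apply/fpsP=> -[|n] //=; rewrite subr0. Qed.

HB.instance Definition _ (K : comNzRingType) :=
  GRing.isZmodMorphism.Build K (fps K) (@fpsC K) (@fpsC_is_zmod_morphism K).
HB.instance Definition _ (K : comNzRingType) :=
  GRing.isMonoidMorphism.Build K (fps K) (@fpsC K) (@fpsC_is_monoid_morphism K).

Lemma fps_derivD (K : comNzRingType) (f g : fps K) :
  fps_deriv (f + g) = fps_deriv f + fps_deriv g.
Proof. by apply/fpsP=> n /=; rewrite mulrnDl. Qed.

Lemma fps_derivN (K : comNzRingType) (f : fps K) :
  fps_deriv (- f) = - fps_deriv f.
Proof. by apply/fpsP=> n /=; rewrite mulNrn. Qed.

Lemma fps_derivC (K : comNzRingType) (a : K) : fps_deriv (fpsC a) = 0.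
Proof. by apply/fpsP=> -[|n] /=; rewrite mul0rn. Qed.

Lemma fps_derivX (K : comNzRingType) : fps_deriv (fpsX K) = 1.
Proof. by apply/fpsP=> -[|n] //=; rewrite mul0rn. Qed.

(** In the coefficient of index n, the factor n + 1 of each term f_i g_(n+1-i) is
    split as i + (n + 1 - i). *)
Lemma fps_derivM (K : comNzRingType) (f g : fps K) :
  fps_deriv (f * g) = fps_deriv f * g + f * fps_deriv g.
Proof.
apply/fpsP=> n; rewrite [LHS]/= fps_coefD !fps_coefM.
transitivity (\sum_(i < n.+2) fps_coef f i * fps_coef g (n.+1 - i) *+ i
   + \sum_(i < n.+2) fps_coef f i * fps_coef g (n.+1 - i) *+ (n.+1 - i)).
  rewrite -sumrMnl -big_split; apply: eq_bigr => i _ /=.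
  by rewrite -mulrnDr subnKC // -ltnS.
rewrite big_ord_recl mulr0n add0r [X in _ + X]big_ord_recr /= subnn mulr0n addr0.
congr (_ + _); apply: eq_bigr => i _ /=; first by rewrite mulrnAl.
by rewrite subSn -1?ltnS // mulrnAr.
Qed.

Lemma fps_derivCM (K : comNzRingType) (a : K) (f : fps K) :
  fps_deriv (fpsC a * f) = fpsC a * fps_deriv f.
Proof. by rewrite fps_derivM fps_derivC mul0r add0r. Qed.

Lemma fps_derivXn (K : comNzRingType) (f : fps K) r :
  fps_deriv (f ^+ r.+1) = r.+1%:R * f ^+ r * fps_deriv f.
Proof.
elim: r => [|r IH]; first by rewrite expr1 expr0 !mul1r.
by rewrite exprS fps_derivM IH -[r.+2%:R]natr1 exprS; ring.
Qed.

(** As f has constant term 1, comparing coefficients of x^n in y' f = g y expresses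
    (n + 1) y_(n+1) through y_0, ..., y_n. *)
Lemma fps_linear_ode_unique (K : comUnitRingType) (f g y z : fps K) :
    (forall n, n.+1%:R \is a @GRing.unit K) -> fps_coef f 0 = 1 ->
    fps_deriv y * f = g * y -> fps_deriv z * f = g * z ->
  fps_coef y 0 = fps_coef z 0 -> y = z.
Proof.
move=> unitS f0 yE zE yz0; apply/eqP; rewrite -subr_eq0; apply/eqP.
have: fps_coef (y - z) 0 = 0 by rewrite fps_coefB yz0 subrr.
have: fps_deriv (y - z) * f = g * (y - z).
  by rewrite fps_derivD fps_derivN mulrBl mulrBr yE zE.
move: (y - z) => d dE d0; apply/fpsP=> n; rewrite fps_coef0.
elim/ltn_ind: n => -[|n] // IH.
move/fpsP/(_ n): dE; rewrite !fps_coefM big_ord_recr /= subnn f0 mulr1.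
rewrite big1 => [|i _]; last by rewrite IH ?mul0rn ?mul0r // ltnS.
rewrite big1 => [|i _]; last by rewrite IH ?mulr0 // ltnS leq_subr.
by rewrite add0r -mulr_natr => /(canRL (mulrK (unitS n))); rewrite mul0r.
Qed.

Lemma gbinomS (K : fieldType) (c : K) j : (forall n, n.+1%:R != 0 :> K) ->
  j.+1%:R * gbinom c j.+1 = (c - j%:R) * gbinom c j.
Proof.
move=> char0; rewrite /gbinom big_ord_recr factS natrM /=.
have fact0 : j`!%:R != 0 :> K by rewrite -(prednK (fact_gt0 j)).
by field; rewrite fact0 addrC natr1 char0.
Qed.

Lemma fps_coefM_eq (K : comNzRingType) (f1 f2 g : fps K) n :
    (forall i, (i <= n)%N -> fps_coef f1 i = fps_coef f2 i) ->
  fps_coef (f1 * g) n = fps_coef (f2 * g) n.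
Proof.
by move=> eqf; rewrite !fps_coefM; apply: eq_bigr => i _; rewrite eqf // -ltnS.
Qed.

(** The truncated binomial series satisfies the equation of (1 + u)^c up to one
    boundary term, the only one that does not telescope under
    (j + 1) binom(c, j + 1) + j binom(c, j) = c binom(c, j).  With u^m as a factor, it
    is invisible in degrees below m when u has no constant term. *)
Lemma binomial_sum_ode (K : fieldType) (u : fps K) (c : K) m :
    (forall n, n.+1%:R != 0 :> K) ->
  fps_deriv (\sum_(j < m.+1) fpsC (gbinom c j) * u ^+ j) * (1 + u)
    + fpsC (m.+1%:R * gbinom c m.+1) * u ^+ m * fps_deriv u
  = fpsC c * fps_deriv u * \sum_(j < m.+1) fpsC (gbinom c j) * u ^+ j.
Proof.
move=> char0; elim: m => [|m IH].
  rewrite big_ord1 fps_derivCM fps_derivC mulr0 mul0r add0r gbinomS // subr0.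
  by rewrite rmorphM /=; ring.
rewrite [in RHS]big_ord_recr [in LHS]big_ord_recr /= [RHS]mulrDr -IH.
rewrite fps_derivD fps_derivCM fps_derivXn [in LHS]gbinomS //.
by rewrite !rmorphM rmorphB /= !rmorph_nat !exprS; ring.
Qed.

Lemma fps_pow_ode (K : fieldType) (f : fps K) (c : K) :
    (forall n, n.+1%:R != 0 :> K) -> fps_coef f 0 = 1 ->
  fps_deriv (fps_pow f c) * f = fpsC c * fps_deriv f * fps_pow f c.
Proof.
move=> char0 f0; apply/fpsP=> n.
(* The derivative at degree n looks at degree n + 1 of the power, hence n + 2
   terms. *)
pose u := f - 1; pose Q := \sum_(j < n.+2) fpsC (gbinom c j) * u ^+ j.
have powE i : (i < n.+2)%N -> fps_coef (fps_pow f c) i = fps_coef Q i.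
  move=> lt_i; rewrite (fps_powE c f0 lt_i) fps_coef_sum.
  by apply: eq_bigr => j _; rewrite fps_coefCM.
rewrite (@fps_coefM_eq _ _ (fps_deriv Q)) => [|i le_i]; last first.
  exact: (congr1 (fun a => a *+ i.+1) (powE i.+1 le_i)).
rewrite [in RHS]mulrC [RHS](@fps_coefM_eq _ _ Q) => [|i le_i]; last first.
  by rewrite powE // ltnW.
have := binomial_sum_ode u c n.+1 char0; rewrite -/Q.
have -> : 1 + u = f by rewrite /u addrC subrK.
have -> : fps_deriv u = fps_deriv f.
  by rewrite fps_derivD fps_derivN fps_derivC oppr0 addr0.
move/fpsP/(_ n); rewrite fps_coefD -mulrA fps_coefCM [X in _ + _ * X]fps_coefM.
rewrite big1 ?mulr0 ?addr0 => [->|i _]; first by rewrite mulrC.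
by rewrite fps_coefX_eq0 ?mul0r // fps_coefB f0 subrr.
Qed.

(** * Three consequences of the recursion *)

Lemma ode_of_convolution (K : fieldType) (t : K) (q : nat -> K) :
    (forall n, n.+1%:R != 0 :> K) -> q 0%N = 1 ->
    (forall n, q n.+1 = \sum_(i < n.+1) (t + i%:R) / i.+1%:R * q i * q (n - i)%N) ->
  let P := FPS q in
  fps_deriv P = fpsX K * P ^+ 2 * fps_deriv P + fpsC t * P ^+ 3.
Proof.
move=> char0 q0 qS P.
pose T : fps K := FPS (fun n => if n is i.+1 then (t + i%:R) / i.+1%:R * q i else 0).
have PE : P = 1 + T * P.
  apply/fpsP=> -[|n]; rewrite fps_coefD fps_coef1 fps_coefM big_ord_recl /=.
    by rewrite big_ord0 mul0r !addr0.
  by rewrite mul0r !add0r qS; apply: eq_bigr => i _; rewrite subSS.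
have derT : fps_deriv T = fpsX K * fps_deriv P + fpsC t * P.
  apply/fpsP=> n; rewrite fps_coefD fps_coefCM.
  have -> : fps_coef (fps_deriv T) n = (t + n%:R) * q n.
    by rewrite /= -[LHS]mulr_natr mulrAC divfK.
  case: n => [|n]; first by rewrite fps_coefXM0 addr0 add0r.
  by rewrite fps_coefXM /= -[X in _ = X + _]mulr_natl mulrDl addrC.
have derP : fps_deriv P = fps_deriv T * P + T * fps_deriv P.
  rewrite {1}PE fps_derivD fps_derivM -[X in X + _]/(fps_deriv (fpsC 1)).
  by rewrite fps_derivC add0r.
(* P is invertible with inverse 1 - T, so P' (1 - T) = T' P becomes P' = P^2 T'. *)
have PT1 : P - T * P = 1 by rewrite {1}PE addrK.
have derPE : fps_deriv P = P ^+ 2 * fps_deriv T.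
  transitivity (fps_deriv P * (P - T * P)); first by rewrite PT1 mulr1.
  transitivity (P * (fps_deriv P - T * fps_deriv P)); first by ring.
  by rewrite {1}derP; ring.
by rewrite [LHS]derPE derT; ring.
Qed.

Lemma convolution_div_fact (K : fieldType) (t : K) (a : nat -> K) n :
    (forall n, n.+1%:R != 0 :> K) ->
    a n.+1 = \sum_(i < n.+1) 'C(n.+1, i.+1)%:R * ((t + i%:R) * a i * a (n - i)%N) ->
  a n.+1 / (n.+1)`!%:R
  = \sum_(i < n.+1) (t + i%:R) / i.+1%:R * (a i / i`!%:R) * (a (n - i)%N / (n - i)`!%:R).
Proof.
move=> char0 ->; have fact0 m : m`!%:R != 0 :> K by rewrite -(prednK (fact_gt0 m)).
rewrite mulr_suml; apply: eq_bigr => i _.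
have -> : 'C(n.+1, i.+1)%:R = (n.+1)`!%:R / ((i.+1)`!%:R * (n - i)`!%:R) :> K.
  by rewrite -natrM -(bin_fact (ltn_ord i)) subSS natrM mulfK // natrM mulf_neq0.
rewrite [(i.+1)`!]factS natrM.
by field; rewrite !fact0 addrC natr1 char0.
Qed.

Lemma fps_coef_deriv (K : comNzRingType) (f : fps K) n :
  fps_coef (fps_deriv f) n = n.+1%:R * fps_coef f n.+1.
Proof. by rewrite mulr_natl. Qed.

Lemma fps_coefX_deriv (K : comNzRingType) (f : fps K) n :
  fps_coef (fpsX K * fps_deriv f) n = n%:R * fps_coef f n.
Proof.
case: n => [|n]; first by rewrite fps_coefXM0 mul0r.
by rewrite fps_coefXM /= mulr_natl.
Qed.

Section ForestEquation.

Variables (K : fieldType) (t : K) (P : fps K).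
Hypothesis char0 : forall n, n.+1%:R != 0 :> K.
Hypothesis P0 : fps_coef P 0 = 1.
Hypothesis odeP : fps_deriv P = fpsX K * P ^+ 2 * fps_deriv P + fpsC t * P ^+ 3.

(** The power and P solve y' f = c f' y with c = t / a, where f is the base of the
    power; for P this is the differential equation, as f' = a (P^2 + 2 x P P') and
    a c = t. *)
Lemma functional_equation_of_ode (a := 2%:R * t - 1) : a != 0 ->
  P = fps_pow (1 + fpsC a * fpsX K * P ^+ 2) (t / a).
Proof.
move=> a0; set f := 1 + _; have f0 : fps_coef f 0 = 1.
  by rewrite fps_coefD -mulrA fps_coefCM fps_coefXM0 mulr0 addr0.
apply: (@fps_linear_ode_unique _ f (fpsC (t / a) * fps_deriv f)) => //.
- by move=> n; rewrite unitfE.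
- have -> : fps_deriv f = fpsC a * (P ^+ 2 + 2%:R * fpsX K * P * fps_deriv P).
    rewrite fps_derivD -mulrA fps_derivCM fps_derivM fps_derivX fps_derivXn.
    by rewrite -[X in X + _]/(fps_deriv (fpsC 1)) fps_derivC; ring.
  rewrite mulrA -rmorphM divfK // /f rmorphB rmorphM rmorph1 rmorph_nat.
  apply/eqP; rewrite -subr_eq0; apply/eqP.
  transitivity (fps_deriv P
    - (fpsX K * P ^+ 2 * fps_deriv P + fpsC t * P ^+ 3)); first by ring.
  by rewrite -odeP subrr.
- exact: fps_pow_ode.
by rewrite P0 /= big_ord1 /gbinom big_ord0 fact0 divr1 mul1r expr0.
Qed.

(** The differential equation times (r + 1) (r + 3) P^r, read at degree n.  It is linear
    because P^2 P' is, up to a factor, again the derivative of a power of P. *)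
Lemma coef_pow_recursion r n :
  r.+3%:R * (n.+1%:R * fps_coef (P ^+ r.+1) n.+1)
  = r.+1%:R * (n%:R + r.+3%:R * t) * fps_coef (P ^+ r.+3) n.
Proof.
have powE : fpsC r.+3%:R * fps_deriv (P ^+ r.+1)
    = fpsC r.+1%:R * (fpsX K * fps_deriv (P ^+ r.+3))
      + fpsC (r.+1%:R * r.+3%:R * t) * P ^+ r.+3.
  rewrite !fps_derivXn !rmorphM /= !rmorph_nat {1}odeP.
  by rewrite !exprS; ring.
move/fpsP/(_ n): powE.
rewrite fps_coefD !fps_coefCM fps_coefX_deriv fps_coef_deriv => ->; ring.
Qed.

(** The exponent must vary: the induction step lowers the degree by one and raises
    the exponent by two. *)
Lemma coef_pow_product r n :
  (n.+1)`!%:R * fps_coef (P ^+ r.+1) n.+1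
  = r.+1%:R * t * \prod_(1 <= i < n.+1) ((r.+1 + 2 * i)%:R * t + (n.+1 - i)%:R).
Proof.
(* Multiplying by r + 3 clears the denominator of the recursion. *)
elim: n r => [|n IH] r; apply: (mulfI (char0 r.+2)).
  rewrite big_geq // mulr1 coef_pow_recursion fps_coefX0 P0 expr1n; ring.
transitivity ((n.+1)`!%:R * (r.+3%:R * (n.+2%:R * fps_coef (P ^+ r.+1) n.+2))).
  by rewrite factS natrM; ring.
rewrite coef_pow_recursion mulrCA IH [in RHS]big_nat_recl //.
under [in RHS]eq_bigr => i _ do rewrite mulnS addnA addn2 subSS.
rewrite mulnS muln0 addn0 addn2 subn1 /=; ring.
Qed.

End ForestEquation.

(** * Passage to Q(t) *)

Lemma tofrac_natr n : tofrac (n%:R : {poly rat}) = n%:R :> Qt.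
Proof. by rewrite tofracMn tofrac1. Qed.

Lemma Qt_char0 n : n.+1%:R != 0 :> Qt.
Proof. by rewrite -tofrac_natr tofrac_eq0 natr_poly_neq0. Qed.

Theorem theorem8 :
  [/\ fps_deriv P_series
        = fpsX Qt * P_series ^+ 2 * fps_deriv P_series
          + fpsC tQ * P_series ^+ 3
      /\ fps_coef P_series 0 = 1,
      P_series
        = fps_pow (1 + fpsC (2%:R * tQ - 1) * fpsX Qt * P_series ^+ 2)
                  (tQ / (2%:R * tQ - 1))
    & forall n : nat, (0 < n)%N ->
        p_poly n
        = 'X * \prod_(1 <= i < n)
                 ((2 * i + 1)%:R * 'X + (n - i)%:R)].
Proof.
have P0 : fps_coef P_series 0 = 1 by rewrite /= p_poly0 rmorph1 divr1.
have odeP : fps_deriv P_series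
    = fpsX Qt * P_series ^+ 2 * fps_deriv P_series + fpsC tQ * P_series ^+ 3.
  apply: ode_of_convolution; [exact: Qt_char0 | exact: P0 | move=> n].
  apply: (@convolution_div_fact _ _ (fun m => tofrac (p_poly m))) Qt_char0 _.
  rewrite p_polyS rmorph_sum; apply: eq_bigr => i _.
  by rewrite /= !tofracM tofracD !tofrac_natr.
split=> //; first apply: functional_equation_of_ode => //; first exact: Qt_char0.
  have -> : 2%:R * tQ - 1 = tofrac (2%:R * 'X - 1).
    by rewrite tofracB tofracM tofrac1 tofrac_natr.
  rewrite tofrac_eq0; apply/eqP=> /polyP/(_ 0%N)/eqP.
  by rewrite coefB coef1 coef0 -polyC_natr coefCM coefX mulr0 sub0r oppr_eq0 oner_eq0.
case=> // n _; apply/eqP; rewrite -tofrac_eq; apply/eqP.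
have := coef_pow_product Qt_char0 P0 odeP 0 n; rewrite expr1 /= mul1r mulrC divfK.
  move=> ->; rewrite tofracM rmorph_prod; congr (_ * _); apply: eq_bigr => i _ /=.
  by rewrite tofracD tofracM !tofrac_natr addnC.
by rewrite -(prednK (fact_gt0 n.+1)) Qt_char0.
Qed.
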